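(* There is an infinite family $\mathcal{G}$ of graphs, each admitting both a strong rectangular layout and a rectangular dual, and constants $c_1,c_2>0$, such that every $G\in\mathcal{G}$ with $n$ vertices satisfies $A^*_s(G)\le c_1 n$ and $A^*_D(G)\ge c_2 n^2$.
   Context: A strong rectangular layout of $G=(V,E)$ is a set of axis-parallel rectangles with pairwise disjoint interiors in bijection with $V$ such that two rectangles' boundaries share a segment of positive length iff the vertices are adjacent. A rectangular dual is a partition of an axis-parallel rectangle into axis-parallel rectangles (no four meeting at a point) in bijection with $V$ such that two rectangles share a boundary segment of positive length iff the vertices are adjacent. Renderings are on the integer grid (integer corners) and the area is that of the smallest enclosing bounding box. $A^*_s(G)$ and $A^*_D(G)$ denote the minimum area of a strong rectangular layout and of a rectangular dual of $G$, respectively. *)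

(* Defs.v *)
From HB Require Import structures.
From mathcomp Require Import all_boot all_order all_algebra.
From mathcomp Require Import all_classical all_reals topology normedtype.
Set Implicit Arguments.
Unset Strict Implicit.
Unset Printing Implicit Defensive.
Import Order.TTheory GRing.Theory Num.Theory.
Import numFieldNormedType.Exports.
Local Open Scope classical_set_scope.
Local Open Scope ring_scope.

Record sgraph := SGraph {
  vertex : finType;
  adj : rel vertex;
  adj_sym : symmetric adj;
  adj_irrefl : irreflexive adj }.
Arguments adj : clear implicits.

Definition order_of (G : sgraph) : nat := #|vertex G|.

Definition graph_iso (G H : sgraph) : Prop :=
  exists f : vertex G -> vertex H,
    bijective f /\ forall u v, adj H (f u) (f v) = adj G u v.

(* Infinite as a family of abstract graphs: relabelled copies of the same graph
   do not count as different members. *)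
Definition infinite_family (F : sgraph -> Prop) : Prop :=
  exists g : nat -> sgraph,
    (forall i, F (g i)) /\ (forall i j, graph_iso (g i) (g j) -> i = j).

(* Nondegenerate axis-parallel rectangle [xlo, xhi] x [ylo, yhi] with integer
   corners. *)
Record rect := Rect {
  xlo : int; xhi : int; ylo : int; yhi : int;
  x_lt : xlo < xhi;
  y_lt : ylo < yhi }.

Definition area (r : rect) : int := (xhi r - xlo r) * (yhi r - ylo r).

Section Layouts.
Variable R : realType.
Implicit Types (r s B : rect) (G : sgraph).

Definition region r : set (R * R) :=
  `[(xlo r)%:~R, (xhi r)%:~R] `*` `[(ylo r)%:~R, (yhi r)%:~R].

Definition boundary (A : set (R * R)) : set (R * R) := closure A `\` interior A.

Definition segment (p q : R * R) : set (R * R) :=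
  [set ((1 - t) * p.1 + t * q.1, (1 - t) * p.2 + t * q.2) | t in `[0, 1]].

Definition share_segment r s : Prop :=
  exists p q : R * R, p <> q /\
    segment p q `<=` boundary (region r) `&` boundary (region s).

Definition disjoint_interiors r s : Prop :=
  interior (region r) `&` interior (region s) = set0.

Definition strong_layout G (L : vertex G -> rect) : Prop :=
  (forall u v, u <> v -> disjoint_interiors (L u) (L v)) /\
  (forall u v, u <> v -> (share_segment (L u) (L v) <-> adj G u v)).

Definition no_four_meet G (L : vertex G -> rect) : Prop :=
  forall (p : R * R) (f : 'I_4 -> vertex G),
    injective f -> ~ (forall i, region (L (f i)) p).

(* The first two clauses say that the rectangles partition B; a partition is
   understood up to boundaries, as usual for dissections. *)
Definition rectangular_dual G (L : vertex G -> rect) : Prop :=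
  [/\ exists B, \bigcup_(v in [set: vertex G]) region (L v) = region B,
      forall u v, u <> v -> disjoint_interiors (L u) (L v),
      no_four_meet L &
      forall u v, u <> v -> (share_segment (L u) (L v) <-> adj G u v)].

Definition bounding_box G (L : vertex G -> rect) B : Prop :=
  (forall v, region (L v) `<=` region B) /\
  (forall B', (forall v, region (L v) `<=` region B') ->
     region B `<=` region B').

Definition layout_areas G (P : (vertex G -> rect) -> Prop) : set int :=
  [set a | exists L B, [/\ P L, bounding_box L B & a = area B]].

(* The least element of S; the value 0 when there is none is junk. *)
Definition min_of (S : set int) : int := xget 0 (S `&` lbound S).

Definition min_strong_area G : int := min_of (layout_areas (@strong_layout G)).

Definition min_dual_area G : int :=
  min_of (layout_areas (@rectangular_dual G)).

End Layouts.

(* Main.v *)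
Require Import Defs.
From mathcomp Require Import all_boot all_order all_algebra.
From mathcomp Require Import all_classical all_reals topology normedtype.
From mathcomp Require Import zify lra.
Set Implicit Arguments.
Unset Strict Implicit.
Unset Printing Implicit Defensive.
Import Order.TTheory GRing.Theory Num.Theory.
Import numFieldNormedType.Exports.
Local Open Scope classical_set_scope.
Local Open Scope ring_scope.

(** In a rectangular dual, a vertex whose neighbours are pairwise adjacent cannot
    have neighbours on two opposite sides, so its rectangle touches a vertical
    and a horizontal side of the bounding box. Of three such vertices, two lie on
    a common vertical side and two on a common horizontal side; walking along
    that side meets a chain of adjacent rectangles, hence both dimensions are at
    least half the distance between the vertices. Taking the square of a path
    with a pendant vertex attached at its middle, the pendant vertex and the two
    ends are three such vertices at linear distance. A strong layout may leave
    gaps, and there the squared path is just two shifted rows of bricks. *)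

Definition sub_rect (r s : rect) : bool :=
  [&& xlo s <= xlo r, xhi r <= xhi s, ylo s <= ylo r & yhi r <= yhi s].

Definition separated (r s : rect) : bool :=
  [|| xhi r <= xlo s, xhi s <= xlo r, yhi r <= ylo s | yhi s <= ylo r].

Definition meets (r s : rect) : bool :=
  [&& xlo r <= xhi s, xlo s <= xhi r, ylo r <= yhi s & ylo s <= yhi r].

(* For separated rectangles only: overlapping ones are in contact as well. *)
Definition contact (r s : rect) : bool :=
  [&& xlo r <= xhi s, xlo s <= xhi r, ylo r < yhi s & ylo s < yhi r]
  || [&& xlo r < xhi s, xlo s < xhi r, ylo r <= yhi s & ylo s <= yhi r].

(** The unit cell with lower left corner [(x, y)], standing for its centre: coverage of real points
    can then be tested on integers. *)
Definition in_cell (r : rect) (x y : int) : bool :=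
  [&& xlo r <= x, x < xhi r, ylo r <= y & y < yhi r].

(** * Integer description of the geometric predicates *)

Section Geometry.
Variable R : realType.
Implicit Types r s B : rect.

Lemma regionE r (p : R * R) :
  @region R r p = ((xlo r)%:~R <= p.1 <= (xhi r)%:~R) &&
                 ((ylo r)%:~R <= p.2 <= (yhi r)%:~R) :> Prop.
Proof.
rewrite /region /setX /= !in_itv /=; apply/propext.
by split=> [[-> ->]|/andP[]].
Qed.

Lemma interior_regionE r (p : R * R) :
  interior (@region R r) p = ((xlo r)%:~R < p.1 < (xhi r)%:~R) &&
                            ((ylo r)%:~R < p.2 < (yhi r)%:~R) :> Prop.
Proof.
apply/propext; case: p => a b /=.
have itvE (c d x : R) : (interior `[c, d] x) = (c < x < d) :> Prop.
  by rewrite interior_itv /= in_itv.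
split.
- rewrite /interior /= => -[[P Q] /= [nP nQ] PQ].
  have aP : P a by exact: nbhs_singleton.
  have bQ : Q b by exact: nbhs_singleton.
  apply/andP; split; rewrite -itvE.
  + by apply: filterS nP => x xP; have [] := PQ (x, b) (conj xP bQ).
  + by apply: filterS nQ => y yQ; have [] := PQ (a, y) (conj aP yQ).
- move=> /andP[+ +]; rewrite -!itvE => ia ib.
  by exists (`[(xlo r)%:~R, (xhi r)%:~R]%classic,
             `[(ylo r)%:~R, (yhi r)%:~R]%classic).
Qed.

Lemma closed_region r : closed (@region R r).
Proof.
have -> : @region R r =
    (fst @^-1` `[(xlo r)%:~R, (xhi r)%:~R]) `&`
    (snd @^-1` `[(ylo r)%:~R, (yhi r)%:~R]) by [].
apply: closedI; apply: preimage_closed => [p _|]; try exact: itv_closed.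
- exact: cvg_fst.
- exact: cvg_snd.
Qed.

(** Cell centres lie on no grid line, so comparisons with them reduce to integer ones. *)
Lemma le_add_half (a x : int) : (a%:~R <= x%:~R + 2^-1 :> R) = (a <= x).
Proof.
apply/idP/idP => [h|]; last by rewrite -(ler_int R); lra.
rewrite -ltzD1 -(ltr_int R) intrD; lra.
Qed.

Lemma add_half_le (x b : int) : (x%:~R + 2^-1 <= b%:~R :> R) = (x < b).
Proof.
apply/idP/idP => [h|]; first by rewrite -(ltr_int R); lra.
rewrite -lezD1 -(ler_int R) intrD; lra.
Qed.

Lemma lt_add_half (a x : int) : (a%:~R < x%:~R + 2^-1 :> R) = (a <= x).
Proof. by rewrite ltNge add_half_le -leNgt. Qed.

Lemma add_half_lt (x b : int) : (x%:~R + 2^-1 < b%:~R :> R) = (x < b).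
Proof. by rewrite ltNge le_add_half -ltNge. Qed.

Lemma region_cell r (x y : int) :
  @region R r (x%:~R + 2^-1, y%:~R + 2^-1) = in_cell r x y :> Prop.
Proof. by rewrite regionE /= !le_add_half !add_half_le /in_cell !andbA. Qed.

Lemma region_subset r s : @region R r `<=` @region R s <-> sub_rect r s.
Proof.
split=> [rs|/and4P[]].
- have := x_lt r; have := y_lt r => yr xr.
  have h1 : @region R r ((xlo r)%:~R, (ylo r)%:~R).
    by rewrite regionE /= !ler_int; lia.
  have h2 : @region R r ((xhi r)%:~R, (yhi r)%:~R).
    by rewrite regionE /= !ler_int; lia.
  move: (rs _ h1) (rs _ h2); rewrite !regionE /= !ler_int /sub_rect; lia.
- rewrite -!(ler_int R) => h1 h2 h3 h4 p; rewrite !regionE; lra.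
Qed.

Lemma region_meets r s (p : R * R) : @region R r p -> @region R s p -> meets r s.
Proof.
rewrite !regionE /meets -!(ler_int R); lra.
Qed.

Lemma disjoint_interiorsP r s : disjoint_interiors R r s <-> separated r s.
Proof.
split=> [rs|h].
- apply: contraPT rs => nsep; apply/eqP/set0P.
  (* The centre of the lower left cell of the overlap is interior to both rectangles. *)
  exists ((Num.max (xlo r) (xlo s))%:~R + 2^-1,
          (Num.max (ylo r) (ylo s))%:~R + 2^-1).
  have := x_lt r; have := y_lt r; have := x_lt s; have := y_lt s.
  move: nsep; rewrite /separated /setI /=.
  by split; rewrite interior_regionE /= !lt_add_half !add_half_lt; lia.
- apply/seteqP; split=> // p [] ; rewrite !interior_regionE.
  by case/or4P: h; rewrite -(ler_int R); lra.
Qed.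

Lemma segment_endpoints (p q : R * R) : segment p q p /\ segment p q q.
Proof.
split; [exists 0|exists 1]; rewrite /= ?in_itv /= ?lexx ?ler01 //.
- by case: p q => a b [c d] /=; congr pair; lra.
- by case: p q => a b [c d] /=; congr pair; lra.
Qed.

Lemma boundary_regionE r (p : R * R) :
  boundary (@region R r) p <-> @region R r p /\ ~ interior (@region R r) p.
Proof. by rewrite /boundary -(proj1 (closure_id _) (@closed_region r)). Qed.

Lemma share_segmentP r s : separated r s -> share_segment R r s <-> contact r s.
Proof.
move=> sep; have := x_lt r; have := y_lt r; have := x_lt s; have := y_lt s.
move=> ys xs yr xr; split.
- case=> p [q [npq pq]]; have [sp sq] := segment_endpoints p q.
  have [/boundary_regionE[rp _] /boundary_regionE[sp' _]] := pq _ sp.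
  have [/boundary_regionE[rq _] /boundary_regionE[sq' _]] := pq _ sq.
  have := region_meets rp sp'; rewrite /meets => m.
  (* Without positive overlap along one axis the rectangles meet in at most one point, forcing
     [p = q]. *)
  suff : (xlo r < xhi s) && (xlo s < xhi r) || (ylo r < yhi s) && (ylo s < yhi r).
    by move: m; rewrite /contact; lia.
  apply: contra_notT npq; move: rp sp' rq sq'.
  rewrite negb_or !negb_and -!leNgt -!(ler_int R) !regionE.
  by case: p q {pq sp sq} => a b [c d] /= *; congr pair; lra.
- move=> c.
  (* The common part is [[x0, x1] x [y0, y1]]. Separation makes it flat, contact makes it more than
     a point, and its diagonal is the shared segment. *)
  pose x0 : int := Num.max (xlo r) (xlo s).
  pose x1 : int := Num.min (xhi r) (xhi s).
  pose y0 : int := Num.max (ylo r) (ylo s).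
  pose y1 : int := Num.min (yhi r) (yhi s).
  have flat : [&& x0 == x1, y0 < y1, (x1 == xlo r) || (x0 == xhi r)
                 & (x1 == xlo s) || (x0 == xhi s)]
           || [&& y0 == y1, x0 < x1, (y1 == ylo r) || (y0 == yhi r)
                 & (y1 == ylo s) || (y0 == yhi s)].
    by move: sep c; rewrite /x0 /x1 /y0 /y1 /separated /contact; lia.
  have [hr hs] : [&& xlo r <= x0, x1 <= xhi r, ylo r <= y0 & y1 <= yhi r] /\
                 [&& xlo s <= x0, x1 <= xhi s, ylo s <= y0 & y1 <= yhi s].
    by rewrite /x0 /x1 /y0 /y1; lia.
  exists (x0%:~R, y0%:~R), (x1%:~R, y1%:~R); split.
    case=> /eqP; rewrite eqr_int => ex /eqP; rewrite eqr_int.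
    by move: ex flat; lia.
  move=> _ [t /= + <-]; rewrite in_itv /= => ht.
  have convex (a b : int) : a <= b ->
      (a%:~R : R) <= (1 - t) * a%:~R + t * b%:~R <= b%:~R.
    by rewrite -(ler_int R) => ?; apply/andP; split; nra.
  have convexE (a : int) : (1 - t) * a%:~R + t * a%:~R = a%:~R :> R by lra.
  case/orP: flat => /and4P[/eqP e lt fr fs].
  + have := convex _ _ (ltW lt); move: ((1 - t) * y0%:~R + t * y1%:~R) => b hb.
    rewrite -e convexE; move: hr hs fr fs; rewrite -e -!(ler_int R) -!(eqr_int R).
    by split; rewrite boundary_regionE regionE interior_regionE /=; lra.
  + have := convex _ _ (ltW lt); move: ((1 - t) * x0%:~R + t * x1%:~R) => b hb.
    rewrite -e convexE; move: hr hs fr fs; rewrite -e -!(ler_int R) -!(eqr_int R).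
    by split; rewrite boundary_regionE regionE interior_regionE /=; lra.
Qed.
End Geometry.

(** * Lower bound for tilings of a rectangle *)

Definition tiling (G : sgraph) (L : vertex G -> rect) (B : rect) : Prop :=
  [/\ forall v, sub_rect (L v) B,
      forall x y, in_cell B x y -> exists v, in_cell (L v) x y,
      forall u v, u <> v -> separated (L u) (L v) &
      forall u v, u <> v -> contact (L u) (L v) = adj G u v].

Definition simplicial (G : sgraph) (v : vertex G) : Prop :=
  forall a b, adj G v a -> adj G v b -> a <> b -> adj G a b.

Lemma rectangular_dual_tiling (R : realType) (G : sgraph) (L : vertex G -> rect) :
  rectangular_dual R L ->
  exists B, tiling L B /\ \bigcup_(v in [set: vertex G]) region (L v) = @region R B.
Proof.
case=> -[B LB] disj _ share; exists B; split=> //.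
have sep u v : u <> v -> separated (L u) (L v).
  by move=> /disj /disjoint_interiorsP.
split=> //.
- by move=> v; apply/(region_subset R); rewrite -LB => p Lp; exists v.
- move=> x y; rewrite -(region_cell R) -LB => -[v _].
  by rewrite region_cell; exists v.
- move=> u v uv; apply/idP/idP.
    by move/(share_segmentP R (sep _ _ uv))/share; apply.
  by move/(share _ _ uv)/(share_segmentP R (sep _ _ uv)).
Qed.

Definition transpose (r : rect) : rect := Rect (y_lt r) (x_lt r).

(** Carries bounds on the height of a tiling over to its width. *)
Lemma tiling_transpose (G : sgraph) (L : vertex G -> rect) (B : rect) :
  tiling L B -> tiling (transpose \o L) (transpose B).
Proof.
case=> sub cov sep con; split=> /= [v|x y h|u v uv|u v uv].
- by have := sub v; rewrite /sub_rect /=; lia.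
- have [|v hv] := cov y x; first by move: h; rewrite /in_cell /=; lia.
  by exists v; move: hv; rewrite /in_cell /=; lia.
- by have := sep u v uv; rewrite /separated /=; lia.
- by rewrite -(con u v uv) /contact /= orbC; congr orb; lia.
Qed.

Section Tiling.
Variables (G : sgraph) (L : vertex G -> rect) (B : rect).
Hypothesis tilLB : tiling L B.

Lemma tiling_left_neighbor v : xlo B < xlo (L v) ->
  exists2 u, adj G v u & xhi (L u) = xlo (L v).
Proof.
case: tilLB => sub cov sep con Bv.
have := x_lt (L v); have := y_lt (L v); have := sub v.
rewrite /sub_rect => sv yv xv.
(* The neighbour is the tile covering the cell just left of the lower left cell of [L v]. *)
have [|u] := cov (xlo (L v) - 1) (ylo (L v)); first by rewrite /in_cell; lia.
rewrite /in_cell => hu.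
have vu : v <> u by move=> vu; move: hu; rewrite vu; lia.
have := sep _ _ vu; rewrite /separated => s.
by exists u; [rewrite -con // /contact|]; lia.
Qed.

Lemma tiling_right_neighbor v : xhi (L v) < xhi B ->
  exists2 u, adj G v u & xlo (L u) = xhi (L v).
Proof.
case: tilLB => sub cov sep con Bv.
have := x_lt (L v); have := y_lt (L v); have := sub v.
rewrite /sub_rect => sv yv xv.
have [|u] := cov (xhi (L v)) (ylo (L v)); first by rewrite /in_cell; lia.
rewrite /in_cell => hu.
have vu : v <> u by move=> vu; move: hu; rewrite vu; lia.
have := sep _ _ vu; rewrite /separated => s.
by exists u; [rewrite -con // /contact|]; lia.
Qed.

(* Neighbours beyond opposite sides of a tile cannot touch each other. *)
Lemma simplicial_touches_side v : simplicial v ->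
  (xlo (L v) == xlo B) || (xhi (L v) == xhi B).
Proof.
move=> simp; case: (tilLB) => sub _ _ con.
have := x_lt (L v); have := sub v; rewrite /sub_rect => sv xv.
apply/negPn/negP; rewrite negb_or => /andP[nl nr].
have [|a va ha] := @tiling_left_neighbor v; first lia.
have [|b vb hb] := @tiling_right_neighbor v; first lia.
have := x_lt (L a); have := x_lt (L b) => xb xa.
have ab : a <> b by move=> ab; move: ha xa; rewrite ab; lia.
have := simp _ _ va vb ab; rewrite -con // /contact; lia.
Qed.

Variables (d : int) (f : vertex G -> int).
Hypothesis lip : forall u v, adj G u v -> `|f u - f v| <= d.
Hypothesis d_ge0 : 0 <= d.

(** Climbing a column of cells, each step stays in one tile or crosses to a touching one, so [f]
    changes by at most [d]. *)
Lemma tiling_column_lipschitz (x y : int) (n : nat) u v :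
  in_cell (L u) x y -> in_cell (L v) x (y + n%:Z) -> `|f u - f v| <= d * n%:Z.
Proof.
case: tilLB => sub cov sep con.
have step z a b : in_cell (L a) x z -> in_cell (L b) x (z + 1) -> `|f a - f b| <= d.
  have [-> _ _|/eqP ab] := eqVneq a b; first by rewrite subrr normr0.
  rewrite /in_cell => ha hb; apply: lip; rewrite -con // /contact; lia.
elim: n v => [|n IH] v hu hv.
  suff -> : u = v by rewrite subrr normr0; lia.
  apply: contrapT => /sep; move: hu hv; rewrite /separated /in_cell; lia.
have [|w hw] := cov x (y + n%:Z).
  by have := sub u; have := sub v; move: hu hv; rewrite /sub_rect /in_cell; lia.
have fuw := IH w hu hw.
have fwv : `|f w - f v| <= d.
  by apply: (step _ _ _ hw); move: hv; rewrite /in_cell; lia.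
have -> : d * n.+1%:Z = d * n%:Z + d by lia.
lia.
Qed.

(** Both tiles meet the first or both meet the last column of cells of [B], and their bottom cells
    differ by at most the height of [B] minus one. *)
Lemma common_side_lipschitz u v :
  (xlo (L u) == xlo B) && (xlo (L v) == xlo B)
    || (xhi (L u) == xhi B) && (xhi (L v) == xhi B) ->
  `|f u - f v| <= d * (yhi B - ylo B - 1).
Proof.
case: (tilLB) => sub cov sep con side.
wlog le_uv : u v side / ylo (L u) <= ylo (L v).
  move=> H; have [|/ltW] := lerP (ylo (L u)) (ylo (L v)); first exact: H.
  by rewrite distrC; apply: H; lia.
have := x_lt (L u); have := y_lt (L u); have := x_lt (L v); have := y_lt (L v).
have := sub u; have := sub v; rewrite /sub_rect => sv su yv xv yu xu.
pose n := `|ylo (L v) - ylo (L u)|%N.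
have hn : ylo (L u) + n%:Z = ylo (L v) by lia.
have : `|f u - f v| <= d * n%:Z.
  case/orP: side => side.
  - by apply: (@tiling_column_lipschitz (xlo B) (ylo (L u))); rewrite /in_cell; lia.
  - by apply: (@tiling_column_lipschitz (xhi B - 1) (ylo (L u))); rewrite /in_cell; lia.
move=> /le_trans; apply; apply: ler_wpM2l => //; lia.
Qed.

End Tiling.

(* Of three simplicial vertices, two lie on the same vertical side. *)
Lemma tiling_height (G : sgraph) (L : vertex G -> rect) (B : rect)
    (d m : int) (f : vertex G -> int) (a b c : vertex G) :
  tiling L B -> 0 <= d -> (forall u v, adj G u v -> `|f u - f v| <= d) ->
  simplicial a -> simplicial b -> simplicial c ->
  m <= `|f a - f b| -> m <= `|f a - f c| -> m <= `|f b - f c| ->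
  m <= d * (yhi B - ylo B - 1).
Proof.
move=> til d0 lip sa sb sc ab ac bc.
have side u v := @common_side_lipschitz _ _ _ til _ _ lip d0 u v.
move: (side a b) (side a c) (side b c).
case/orP: (simplicial_touches_side til sa) => ->;
case/orP: (simplicial_touches_side til sb) => ->;
case/orP: (simplicial_touches_side til sc) => ->; rewrite /= ?orbT => hab hac hbc;
  by [apply: le_trans (hab isT) | apply: le_trans (hac isT) | apply: le_trans (hbc isT)].
Qed.

(** * From integer rectangles to layouts *)

Section Layouts.
Variables (R : realType) (G : sgraph) (L : vertex G -> rect).

Lemma separated_strong_layout :
  (forall u v, u <> v -> separated (L u) (L v)) ->
  (forall u v, u <> v -> contact (L u) (L v) = adj G u v) ->
  strong_layout R L.
Proof.
move=> sep con; split=> u v uv; first exact/disjoint_interiorsP/sep.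
by rewrite -con //; apply/share_segmentP/sep.
Qed.

Lemma real_in_unit_interval (a b : int) (x : R) :
  a < b -> a%:~R <= x <= b%:~R ->
  exists2 i : int, a <= i < b & i%:~R <= x <= (i + 1)%:~R.
Proof.
move=> ab /andP[ax xb]; have [xb'|bx] := ltP x b%:~R.
- exists (Num.floor x); last by rewrite floor_le /= ltW // floorD1_gt.
  by rewrite floor_ge_int ax floor_lt_int.
(* At [x = b] the floor would leave the range, so the last unit interval is taken. *)
- exists (b - 1); first lia.
  by rewrite subrK xb andbT (le_trans _ bx) // ler_int; lia.
Qed.

Lemma tiling_bigcup (B : rect) : tiling L B ->
  \bigcup_(v in [set: vertex G]) region (L v) = @region R B.
Proof.
case=> sub cov _ _; apply/seteqP; split=> [p [v _]|p].
  by apply: (proj2 (region_subset R _ _)); exact: sub.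
rewrite regionE => /andP[px py].
have [i iB ip] := real_in_unit_interval (x_lt B) px.
have [j jB jp] := real_in_unit_interval (y_lt B) py.
have [|v] := cov i j; first by rewrite /in_cell; lia.
rewrite /in_cell => hv; exists v => //; rewrite regionE.
have : [&& xlo (L v) <= i, i + 1 <= xhi (L v), ylo (L v) <= j & j + 1 <= yhi (L v)].
  lia.
rewrite -!(ler_int R); lra.
Qed.

(** Four tiles through one point meet pairwise, so their vertices would form a [K4]. *)
Lemma tiling_rectangular_dual (B : rect) : tiling L B ->
  (forall u v, u <> v -> meets (L u) (L v) -> adj G u v) ->
  (forall f : 'I_4 -> vertex G, ~ (forall i k, i <> k -> adj G (f i) (f k))) ->
  rectangular_dual R L.
Proof.
move=> til meetsP noK4; case: (til) => _ _ sep con.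
have [disj share] := separated_strong_layout sep con.
split=> //; first by exists B; exact: tiling_bigcup.
move=> p f injf fp; apply: (noK4 f) => i k ik.
apply: meetsP => [/injf//|]; exact: region_meets (fp i) (fp k).
Qed.

Lemma extremal_bounding_box (B : rect) :
  (forall v, sub_rect (L v) B) ->
  (exists v, xlo (L v) = xlo B) -> (exists v, xhi (L v) = xhi B) ->
  (exists v, ylo (L v) = ylo B) -> (exists v, yhi (L v) = yhi B) ->
  bounding_box R L B.
Proof.
move=> sub [a ha] [b hb] [c hc] [e he]; split=> [v|B' sub'].
  exact/region_subset/sub.
have sub'' v : sub_rect (L v) B' by apply/(region_subset R)/sub'.
apply/region_subset.
move: (sub'' a) (sub'' b) (sub'' c) (sub'' e); rewrite /sub_rect; lia.
Qed.

End Layouts.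

(** * Attainment of minimal areas *)

Lemma min_ofP (S : set int) (a : int) : S a -> (forall b, S b -> 0 <= b) ->
  S (min_of S) /\ lbound S (min_of S).
Proof.
move=> Sa S0; apply: (@xgetPex _ 0 (S `&` lbound S)).
have exS : exists n : nat, `[< S n%:Z >].
  by exists `|a|%N; apply/asboolP; rewrite gez0_abs // S0.
case: (ex_minnP exS) => n /asboolP Sn minn; exists n%:Z; split=> // b Sb.
have := minn `|b|%N; have b0 := S0 _ Sb; rewrite gez0_abs // => H.
have : (n <= `|b|)%N by apply/H/asboolP.
lia.
Qed.

Lemma area_ge0 (r : rect) : 0 <= area r.
Proof. by rewrite /area mulr_ge0 // subr_ge0 ltW // (x_lt, y_lt). Qed.

(** One layout serves twice: it bounds the minimum from above, and it shows that the minimum is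
    attained rather than the default [0]. *)
Lemma layout_areas_min (R : realType) (G : sgraph)
    (P : (vertex G -> rect) -> Prop) (L : vertex G -> rect) (B : rect) :
  P L -> bounding_box R L B ->
  layout_areas R P (min_of (layout_areas R P)) /\ min_of (layout_areas R P) <= area B.
Proof.
move=> PL LB; have areasB : layout_areas R P (area B) by exists L, B.
have [|Pmin lbP] := min_ofP areasB; last by split=> //; exact: lbP.
by move=> _ [L' [B' [_ _ ->]]]; exact: area_ge0.
Qed.

(** * The square of a path with a pendant vertex at its middle *)

Section Family.
Variable j : nat.

(** [None] is the pendant vertex. Centring puts it and the middle of the path, of index [2j+1], both
    at position 0. *)
Definition pos (v : option 'I_(4 * j + 3)) : int :=
  if v is Some i then (i : nat)%:Z - (2 * j + 1)%:Z else 0.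

Definition spath_adj (u v : option 'I_(4 * j + 3)) : bool :=
  match u, v with
  | Some i, Some k => (i != k) && (`|pos u - pos v| <= 2)
  | None, None => false
  | _, _ => (pos u == 0) && (pos v == 0)
  end.

Lemma spath_adj_sym : symmetric spath_adj.
Proof.
move=> [i|] [k|] //=; last by rewrite andbC.
- by rewrite eq_sym distrC.
- by rewrite andbC.
Qed.

Lemma spath_adj_irrefl : irreflexive spath_adj.
Proof. by move=> [i|] //=; rewrite eqxx. Qed.

Definition spath : sgraph := SGraph spath_adj_sym spath_adj_irrefl.

Lemma order_spath : order_of spath = (4 * j + 4)%N.
Proof. by rewrite /order_of card_option card_ord -addnS. Qed.

Lemma spath_lipschitz u v : adj spath u v -> `|pos u - pos v| <= 2.
Proof. by case: u v => [i|] [k|] //=; lia. Qed.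

(** Pairwise adjacent path vertices fit in a window of three positions, and the pendant vertex has a
    single neighbour. *)
Lemma spath_noK4 (f : 'I_4 -> vertex spath) :
  ~ (forall i k, i <> k -> adj spath (f i) (f k)).
Proof.
pose o (i : nat) (h : (i < 4)%N) := Ordinal h.
pose a := @o 0%N isT; pose b := @o 1%N isT; pose c := @o 2%N isT; pose d := @o 3%N isT.
move=> K4.
have [ab ac ad] : [/\ a <> b, a <> c & a <> d] by [].
have [bc bd cd] : [/\ b <> c, b <> d & c <> d] by [].
move: (K4 _ _ ab) (K4 _ _ ac) (K4 _ _ ad) (K4 _ _ bc) (K4 _ _ bd) (K4 _ _ cd).
rewrite /=; case: (f a) (f b) (f c) (f d) => [x|] [y|] [z|] [t|] //=;
  rewrite -?val_eqE /=; lia.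
Qed.

(** * A strong layout of linear area *)

Definition brick_row (v : option 'I_(4 * j + 3)) : int :=
  if v is Some i then (~~ odd i)%:Z else -1.

Lemma brick_x_lt v : pos v - 1 < pos v + 1. Proof. lia. Qed.
Lemma brick_y_lt v : brick_row v < brick_row v + 1. Proof. lia. Qed.

(* Two rows of bricks of length 2, shifted by one; the pendant vertex lies
   below the middle brick, whose index 2j+1 is odd. *)
Definition brick (v : vertex spath) : rect := Rect (brick_x_lt v) (brick_y_lt v).

Lemma brick_separated u v : u <> v -> separated (brick u) (brick v).
Proof.
rewrite /separated; case: u v => [i|] [k|] //= /eqP; try (by lia).
by rewrite (inj_eq Some_inj) -val_eqE /=; lia.
Qed.

Lemma brick_contact u v : u <> v -> contact (brick u) (brick v) = adj spath u v.
Proof.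
rewrite /contact; case: u v => [i|] [k|] //= /eqP; try (by lia).
by rewrite (inj_eq Some_inj) -val_eqE /=; lia.
Qed.

Lemma brick_box_x_lt : - (2 * j + 2)%:Z < (2 * j + 2)%:Z. Proof. lia. Qed.
Lemma brick_box_y_lt : (-1 : int) < 2. Proof. by []. Qed.

Lemma first_index : (0 < 4 * j + 3)%N. Proof. lia. Qed.
Lemma last_index : (4 * j + 2 < 4 * j + 3)%N. Proof. lia. Qed.

Definition first_vertex : vertex spath := Some (Ordinal first_index).
Definition last_vertex : vertex spath := Some (Ordinal last_index).

Lemma brick_bounding_box (R : realType) :
  bounding_box R brick (Rect brick_box_x_lt brick_box_y_lt).
Proof.
apply: extremal_bounding_box.
- by case=> [i|]; rewrite /sub_rect /=; [have := ltn_ord i|]; lia.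
- by exists first_vertex => /=; lia.
- by exists last_vertex => /=; lia.
- by exists None.
- by exists first_vertex.
Qed.

(** * A rectangular dual *)

Definition nest_xlo (v : option 'I_(4 * j + 3)) : int :=
  if v is Some i then (uphalf `|pos v|%N)%:Z else -1.

Definition nest_xhi (v : option 'I_(4 * j + 3)) : int :=
  if v isn't Some i then 0
  else if odd `|pos v|%N then (j + 2)%:Z else (`|pos v|./2 + 1)%:Z.

(** Distances from the line [y = 0] to the near and the far side of the tile at position [k] or
    [-k]. *)
Definition nest_inner (k : nat) : int := k./2%:Z.
Definition nest_outer (k : nat) : int := if odd k then (k./2 + 1)%:Z else (j + 1)%:Z.

Definition nest_ylo (v : option 'I_(4 * j + 3)) : int :=
  if 0 < pos v then nest_inner `|pos v|%N else - nest_outer `|pos v|%N.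

Definition nest_yhi (v : option 'I_(4 * j + 3)) : int :=
  if pos v < 0 then - nest_inner `|pos v|%N else nest_outer `|pos v|%N.

Lemma pos_bound v : `|pos v| <= (2 * j + 1)%:Z.
Proof. by case: v => [i|] /=; [have := ltn_ord i|]; lia. Qed.

Lemma nest_x_lt v : nest_xlo v < nest_xhi v.
Proof.
have := pos_bound v; rewrite /nest_xlo /nest_xhi; case: v => [i|] //.
by case: ifP; lia.
Qed.

Lemma nest_y_lt v : nest_ylo v < nest_yhi v.
Proof.
have := pos_bound v; rewrite /nest_ylo /nest_yhi /nest_inner /nest_outer.
by case: (ltgtP 0 (pos v)); case: ifP; lia.
Qed.

(* The positive positions recede into the upper right corner, alternately as
   the left column and the bottom row of what remains; the negative positions
   mirror them, and the middle and pendant vertices are full columns. *)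
Definition nest (v : vertex spath) : rect := Rect (nest_x_lt v) (nest_y_lt v).

(** Closed forms free of halving and parity tests, which leave only linear arithmetic in the case
    analyses; [h] is half the distance from the middle, rounded down. *)
Variant nest_spec : bool -> int -> int -> int -> int -> int -> Prop :=
| NestPendant : nest_spec true 0 (-1) 0 (- (j%:Z + 1)) (j%:Z + 1)
| NestMiddle : nest_spec false 0 0 1 (- (j%:Z + 1)) (j%:Z + 1)
| NestUpColumn (h : int) of 0 < h <= j%:Z :
    nest_spec false (2 * h) h (h + 1) h (j%:Z + 1)
| NestUpRow (h : int) of 0 <= h <= j%:Z :
    nest_spec false (2 * h + 1) (h + 1) (j%:Z + 2) h (h + 1)
| NestDownColumn (h : int) of 0 < h <= j%:Z :
    nest_spec false (- (2 * h)) h (h + 1) (- (j%:Z + 1)) (- h)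
| NestDownRow (h : int) of 0 <= h <= j%:Z :
    nest_spec false (- (2 * h + 1)) (h + 1) (j%:Z + 2) (- (h + 1)) (- h).

Lemma nestP v : nest_spec (v == None) (pos v)
  (nest_xlo v) (nest_xhi v) (nest_ylo v) (nest_yhi v).
Proof.
have cast b z x0 x1 y0 y1 z' x0' x1' y0' y1' : nest_spec b z x0 x1 y0 y1 ->
    [/\ z = z', x0 = x0', x1 = x1', y0 = y0' & y1 = y1'] ->
    nest_spec b z' x0' x1' y0' y1'.
  by move=> ? [<- <- <- <- <-].
have := pos_bound v; rewrite /nest_xlo /nest_xhi /nest_ylo /nest_yhi.
rewrite /nest_inner /nest_outer.
case: v => [i|_]; last by apply: cast NestPendant _; split=> /=; lia.
rewrite (_ : (Some i == None) = false) //; set z := pos _ => zb.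
pose h := (`|z|./2)%:Z.
case: (ltgtP 0 z) => [z0|z0|z0].
- have [oz|ez] := boolP (odd `|z|).
  + by apply: (cast _ _ _ _ _ _ _ _ _ _ _ (@NestUpRow h _)) => [|]; [|split]; lia.
  + by apply: (cast _ _ _ _ _ _ _ _ _ _ _ (@NestUpColumn h _)) => [|]; [|split]; lia.
- have [oz|ez] := boolP (odd `|z|).
  + by apply: (cast _ _ _ _ _ _ _ _ _ _ _ (@NestDownRow h _)) => [|]; [|split]; lia.
  + by apply: (cast _ _ _ _ _ _ _ _ _ _ _ (@NestDownColumn h _)) => [|]; [|split]; lia.
- by rewrite -z0; apply: cast NestMiddle _; split=> /=; lia.
Qed.

(** Only the pendant and the middle vertex share a position, hence the extra test for [None]. *)
Lemma pos_neq (u v : vertex spath) : u <> v ->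
  ((u == None) (+) (v == None)) || (pos u != pos v).
Proof.
case: u v => [i|] [k|] //= /eqP.
by rewrite (inj_eq Some_inj) -val_eqE /= (inj_eq (addIr _)) eqz_nat.
Qed.

Lemma spath_adjE (u v : vertex spath) : u <> v -> adj spath u v =
  if (u == None) || (v == None) then (pos u == 0) && (pos v == 0)
  else `|pos u - pos v| <= 2.
Proof. by case: u v => [i|] [k|] //= /eqP; rewrite (inj_eq Some_inj) => ->. Qed.

Lemma nest_separated u v : u <> v -> separated (nest u) (nest v).
Proof.
move=> /pos_neq; rewrite /separated /=.
by case: (nestP u) => [||? +|? +|? +|? +];
  case: (nestP v) => [||? +|? +|? +|? +] /=; lia.
Qed.

(** Excludes tiles that touch only at a corner, and with them four tiles at a point. *)
Lemma nest_meets u v : u <> v -> meets (nest u) (nest v) -> adj spath u v.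
Proof.
move=> uv; rewrite spath_adjE //; have := pos_neq uv; rewrite /meets /=.
by case: (nestP u) => [||? +|? +|? +|? +];
  case: (nestP v) => [||? +|? +|? +|? +] /=; lia.
Qed.

Lemma nest_contact u v : u <> v -> contact (nest u) (nest v) = adj spath u v.
Proof.
move=> uv; apply/idP/idP => [h|].
  by apply: nest_meets => //; move: h; rewrite /contact /meets; lia.
rewrite spath_adjE //; have := pos_neq uv; rewrite /contact /=.
by case: (nestP u) => [||? +|? +|? +|? +];
  case: (nestP v) => [||? +|? +|? +|? +] /=; lia.
Qed.

Lemma nest_box_x_lt : -1 < j%:Z + 2. Proof. lia. Qed.
Lemma nest_box_y_lt : - (j%:Z + 1) < j%:Z + 1. Proof. lia. Qed.
Definition nest_box : rect := Rect nest_box_x_lt nest_box_y_lt.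

Lemma pos_surj (z : int) : `|z| <= (2 * j + 1)%:Z ->
  exists2 v : vertex spath, v != None & pos v = z.
Proof.
move=> hz; have lt : (`|(z + (2 * j + 1)%:Z)%R| < 4 * j + 3)%N by lia.
by exists (Some (Ordinal lt)) => //=; lia.
Qed.

Lemma nest_tiling : tiling nest nest_box.
Proof.
split; [|move=> x y xy|exact: nest_separated|exact: nest_contact].
- by move=> v; rewrite /sub_rect /=; case: (nestP v) => *; lia.
- have [x1|x1] := eqVneq x (-1).
    exists None; move: xy.
    by rewrite /in_cell /= /nest_ylo /nest_yhi /nest_outer /= x1; lia.
  move: xy; rewrite /in_cell /= => xy.
  (* Cells with [x <= y] lie in upper columns (or the middle one), those with [x + y <= -1] in lower
     columns. The others lie in rows, where [2 * y + 1] is the position for either sign of [y]. *)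
  pose k := if x <= y then 2 * x else if x <= - 1 - y then - (2 * x) else 2 * y + 1.
  have [|v vN vk] := @pos_surj k; first by rewrite /k; do 2?case: ifP; lia.
  exists v; move: vN vk; rewrite /k /=.
  by case: (nestP v) => [||? +|? +|? +|? +] //=; do 2?case: ifP; lia.
Qed.

Lemma nest_bounding_box (R : realType) : bounding_box R nest nest_box.
Proof.
case: nest_tiling => sub _ _ _.
(* The row at position 1 extends to the right side of the box. *)
have [a aN pa] := @pos_surj 1 ltac:(lia).
apply: extremal_bounding_box => //.
- by exists None; rewrite /= /nest_ylo /nest_yhi /nest_outer /=; lia.
- by exists a => /=; move: aN pa; case: (nestP a) => *; lia.
- by exists None; rewrite /= /nest_ylo /nest_yhi /nest_outer /=; lia.
- by exists None; rewrite /= /nest_ylo /nest_yhi /nest_outer /=; lia.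
Qed.

(** The pendant vertex has one neighbour, and an end of the path only the next two vertices, which
    are adjacent. *)
Lemma spath_simplicial (v : vertex spath) :
  v \in [:: None; first_vertex; last_vertex] -> simplicial v.
Proof.
rewrite !inE => vP a b va vb ab; rewrite spath_adjE //; move: va vb (pos_neq ab).
have := pos_bound a; have := pos_bound b.
case/or3P: vP => /eqP->; case: a b {ab} => [i|] [k|] //=;
  rewrite -?val_eqE /=; lia.
Qed.

End Family.

(** * Area bounds for the family *)

Lemma spath_iso_inj (i k : nat) : graph_iso (spath i) (spath k) -> i = k.
Proof.
case=> f [/bij_eq_card + _]; rewrite -/(order_of (spath i)) -/(order_of (spath k)).
rewrite !order_spath; lia.
Qed.

Lemma spath_min_strong_area (R : realType) (j : nat) :
  min_strong_area R (spath j) <= (3 * (4 * j + 4))%:Z.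
Proof.
have [] := layout_areas_min
  (separated_strong_layout R (@brick_separated j) (@brick_contact j))
  (brick_bounding_box j R).
by move=> _ /le_trans; apply; rewrite /area /=; lia.
Qed.

Lemma spath_rectangular_dual (R : realType) (j : nat) :
  rectangular_dual R (@nest j).
Proof.
exact: tiling_rectangular_dual (nest_tiling j) (@nest_meets j) (@spath_noK4 j).
Qed.

Lemma spath_min_dual_area (R : realType) (j : nat) :
  (j%:Z + 1) ^+ 2 <= min_dual_area R (spath j).
Proof.
(* As a dual exists, the minimum is the area of an actual dual. *)
have [[L [B [dualL [subB _] eqB]]] _] :=
  layout_areas_min (spath_rectangular_dual R j) (nest_bounding_box j R).
rewrite /min_dual_area {}eqB.
have [B0 [til LB0]] := rectangular_dual_tiling dualL.
have : sub_rect B0 B.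
  by apply/(region_subset R); rewrite -LB0 => p [v _]; exact: subB.
have sN : simplicial (None : vertex (spath j)).
  by apply: spath_simplicial; rewrite !inE eqxx.
have s0 : simplicial (first_vertex j).
  by apply: spath_simplicial; rewrite !inE eqxx orbT.
have s1 : simplicial (last_vertex j).
  by apply: spath_simplicial; rewrite !inE eqxx !orbT.
(* The positions [0], [-(2j+1)] and [2j+1] are pairwise at least [2j+1] apart, and adjacent
   positions differ by at most 2. *)
have tall (L' : vertex (spath j) -> rect) B' : tiling L' B' ->
    (2 * j + 1)%:Z <= 2 * (yhi B' - ylo B' - 1).
  move=> til'; apply: (tiling_height til' _ (@spath_lipschitz j) sN s0 s1) => //=; lia.
move: (tall _ _ til) (tall _ _ (tiling_transpose til)); rewrite /sub_rect /area /=.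
nia.
Qed.

Theorem theorem12 (R : realType) :
  exists (F : sgraph -> Prop) (c1 c2 : R),
    infinite_family F /\ 0 < c1 /\ 0 < c2 /\
    forall G : sgraph, F G ->
      (exists L : vertex G -> rect, strong_layout R L) /\
      (exists L : vertex G -> rect, rectangular_dual R L) /\
      (min_strong_area R G)%:~R <= c1 * (order_of G)%:R /\
      c2 * (order_of G)%:R ^+ 2 <= (min_dual_area R G)%:~R.
Proof.
(* The bricks fill a box of height 3 and width [4j+4], the order [n]. The dual bound [(j+1)^2] is
   [n^2 / 16]. *)
exists (fun G => exists j, G = spath j), 3, (16^-1); split.
  by exists spath; split=> [i|]; [exists i|exact: spath_iso_inj].
split; first lra.
split; first lra.
move=> G [j ->]; rewrite order_spath; split.
  exists (@brick j).
  exact: separated_strong_layout (@brick_separated j) (@brick_contact j).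
split; first by exists (@nest j); exact: spath_rectangular_dual.
split.
- by rewrite -natrM pmulrn ler_int spath_min_strong_area.
- apply: (@le_trans _ _ ((j%:Z + 1) ^+ 2)%:~R).
    by rewrite rmorphXn /= intrD natrD natrM; nra.
  by rewrite ler_int spath_min_dual_area.
Qed.
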